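(* Let $m\ge 2$, $n\ge 1$ and let $\mathcal{A}$ be a real $m$-order $n$-dimensional symmetric tensor. Then: (a) $\mathcal{A}$ always has a Pareto $H$-eigenvalue. $\mathcal{A}$ is copositive if and only if all of its Pareto $H$-eigenvalues are nonnegative, and $\mathcal{A}$ is strictly copositive if and only if all of its Pareto $H$-eigenvalues are positive. (b) $\mathcal{A}$ always has a Pareto $Z$-eigenvalue. $\mathcal{A}$ is copositive if and only if all of its Pareto $Z$-eigenvalues are nonnegative, and $\mathcal{A}$ is strictly copositive if and only if all of its Pareto $Z$-eigenvalues are positive.
   Context: An $m$-order $n$-dimensional real tensor is an array $\mathcal{A}=(a_{i_1\cdots i_m})$ of real numbers, $i_1,\ldots,i_m\in\{1,\ldots,n\}$; it is symmetric if its entries are invariant under any permutation of the indices. For $x\in\mathbb{R}^n$, $\mathcal{A}x^m=\sum_{i_1,\ldots,i_m=1}^n a_{i_1\cdots i_m}x_{i_1}\cdots x_{i_m}$, and $\mathcal{A}x^{m-1}\in\mathbb{R}^n$ is the vector with components $(\mathcal{A}x^{m-1})_i=\sum_{i_2,\ldots,i_m=1}^n a_{ii_2\cdots i_m}x_{i_2}\cdots x_{i_m}$. Write $x^{[m-1]}=(x_1^{m-1},\ldots,x_n^{m-1})^T$. Vector inequalities are componentwise, and $\mathbb{R}^n_+=\{x\in\mathbb{R}^n: x\ge 0\}$. A real number $\lambda$ is a Pareto $H$-eigenvalue of $\mathcal{A}$ if there is a non-zero $x\in\mathbb{R}^n$ with $\mathcal{A}x^m=\lambda x^Tx^{[m-1]}$,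 $\mathcal{A}x^{m-1}-\lambda x^{[m-1]}\ge 0$ and $x\ge 0$. A real number $\mu$ is a Pareto $Z$-eigenvalue of $\mathcal{A}$ if there is a non-zero $x\in\mathbb{R}^n$ with $\mathcal{A}x^m=\mu (x^Tx)^{\frac{m}{2}}$, $\mathcal{A}x^{m-1}-\mu (x^Tx)^{\frac{m}{2}-1}x\ge 0$ and $x\ge 0$. A symmetric tensor $\mathcal{A}$ is copositive if $\mathcal{A}x^m\ge 0$ for all $x\in\mathbb{R}^n_+$, and strictly copositive if $\mathcal{A}x^m>0$ for all $x\in\mathbb{R}^n_+\setminus\{0\}$. *)

(* Defs.v *)
From HB Require Import structures.
From mathcomp Require Import all_boot all_order all_algebra all_fingroup.
From mathcomp Require Import all_classical all_reals exp.

Set Implicit Arguments.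
Unset Strict Implicit.
Unset Printing Implicit Defensive.

Import Order.TTheory GRing.Theory Num.Theory.
Local Open Scope ring_scope.

Definition tensor (R : realType) (m n : nat) := {ffun m.-tuple 'I_n -> R}.

Definition symmetric_tensor (R : realType) (m n : nat) (A : tensor R m n) : Prop :=
  forall (s : 'S_m) (t : m.-tuple 'I_n), A [tuple tnth t (s k) | k < m] = A t.

(* A x^m *)
Definition tform (R : realType) (m n : nat) (A : tensor R m n) (x : 'cV[R]_n) : R :=
  \sum_(t : m.-tuple 'I_n) A t * \prod_(k < m) x (tnth t k) 0.

(* A x^(m-1); the value for m = 0, where there is no first index, is junk. *)
Definition tgrad (R : realType) (m n : nat) : tensor R m n -> 'cV[R]_n -> 'cV[R]_n :=
  match m return tensor R m n -> 'cV[R]_n -> 'cV[R]_n with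
  | 0 => fun _ _ => 0
  | p.+1 => fun A x =>
      \col_i \sum_(t : p.-tuple 'I_n) A (cons_tuple i t) * \prod_(k < p) x (tnth t k) 0
  end.

Definition dotv (R : realType) (n : nat) (x y : 'cV[R]_n) : R := (x^T *m y) 0 0.

(* x^[k] *)
Definition powv (R : realType) (n : nat) (x : 'cV[R]_n) (k : nat) : 'cV[R]_n :=
  map_mx (fun a => a ^+ k) x.

Definition nonnegv (R : realType) (n : nat) (x : 'cV[R]_n) : Prop :=
  forall i, 0 <= x i 0.

Definition pareto_H_eigenvalue (R : realType) (m n : nat) (A : tensor R m n)
    (lambda : R) : Prop :=
  exists x : 'cV[R]_n,
    [/\ x != 0,
        tform A x = lambda * dotv x (powv x m.-1),
        nonnegv (tgrad A x - lambda *: powv x m.-1)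
      & nonnegv x].

(* m may be odd, so the powers of x^T x have real exponents (powR). *)
Definition pareto_Z_eigenvalue (R : realType) (m n : nat) (A : tensor R m n)
    (mu : R) : Prop :=
  exists x : 'cV[R]_n,
    [/\ x != 0,
        tform A x = mu * dotv x x `^ (m%:R / 2),
        nonnegv (tgrad A x - (mu * dotv x x `^ (m%:R / 2 - 1)) *: x)
      & nonnegv x].

Definition copositive (R : realType) (m n : nat) (A : tensor R m n) : Prop :=
  forall x : 'cV[R]_n, nonnegv x -> 0 <= tform A x.

Definition strictly_copositive (R : realType) (m n : nat) (A : tensor R m n) : Prop :=
  forall x : 'cV[R]_n, nonnegv x -> x != 0 -> 0 < tform A x.

(* Main.v *)
Require Import Defs.
From HB Require Import structures.
From mathcomp Require Import all_boot all_order all_algebra all_fingroup.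
From mathcomp Require Import all_classical all_reals exp.
From mathcomp Require Import topology normedtype derive realfun ring.

(** Let G(x) be x^T x^[m-1] (H-eigenvalues) or (x^T x)^(m/2) (Z-eigenvalues); it
    is positive on the nonzero nonnegative vectors and homogeneous of degree m,
    like the form A x^m.  Hence A x^m / G(x) attains a minimum lambda on the
    standard simplex, and A y^m >= lambda G(y) for all y >= 0 by homogeneity.
    The function A y^m - lambda G(y) vanishes at the minimizer x and is
    nonnegative along each ray x + t e_i, t >= 0, so its derivative at t = 0 is
    nonnegative; by the symmetry of A this is the vector inequality in the
    definition of an eigenvalue.  So lambda is an eigenvalue, and, as every
    eigenvalue is a value of A x^m / G(x), it is the least one; its sign decides
    copositivity. *)

Set Implicit Arguments.
Unset Strict Implicit.
Unset Printing Implicit Defensive.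
Import Order.TTheory GRing.Theory Num.Theory.
Import numFieldNormedType.Exports.
Local Open Scope classical_set_scope.
Local Open Scope ring_scope.

(** The Leibniz rule at 0, in terms of coefficients; it differentiates the product of the m affine
    factors of a monomial. *)
Lemma coef1_prod (R : comNzRingType) (m : nat) (p : 'I_m -> {poly R}) :
  (\prod_k p k)`_1 = \sum_k (p k)`_1 * \prod_(l | l != k) (p l)`_0.
Proof.
elim: m p => [|m IH] p; first by rewrite !big_ord0 coef1.
rewrite !big_ord_recl coefM !big_ord_recl big_ord0 /= addr0 IH coef0_prod addrC.
congr (_ + _).
  by congr (_ * _); rewrite [in RHS]big_mkcond big_ord_recl /= mul1r.
rewrite mulr_sumr; apply: eq_bigr => k _.
rewrite mulrCA; congr (_ * _).
by rewrite [in RHS]big_mkcond big_ord_recl /= big_mkcond /=; congr (_ * _).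
Qed.

(** * The form A x^m and its derivative along coordinate lines *)

Section Tensor.
Variables (R : realType) (p n : nat) (A : tensor R p.+1 n).
Implicit Types (x y : 'cV[R]_n).

(** Summing over full index tuples, with an indicator pinning the first index, makes the first slot
    interchangeable with the others. *)
Lemma tgradE x i :
  tgrad A x i 0 = \sum_t A t * ((tnth t ord0 == i)%:R *
    \prod_(l | l != ord0) x (tnth t l) 0).
Proof.
rewrite mxE [RHS](reindex (fun u : 'I_n * p.-tuple 'I_n => cons_tuple u.1 u.2)).
  rewrite -(pair_bigA _ (fun j t => A (cons_tuple j t) *
    ((tnth (cons_tuple j t) ord0 == i)%:R *
    \prod_(l | l != ord0) x (tnth (cons_tuple j t) l) 0))) /=.
  rewrite (bigD1 i) //= [X in _ = _ + X]big1 ?addr0; last first.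
    by move=> j ji; apply: big1 => t _; rewrite (negbTE ji) mul0r mulr0.
  apply: eq_bigr => t _; rewrite tnth0 eqxx mul1r; congr (_ * _).
  rewrite [in RHS]big_mkcond big_ord_recl /= mul1r.
  by apply: eq_bigr => l _; rewrite tnthS.
exists (fun t => (thead t, behead_tuple t)) => [[j t]|t] _ /=.
  by rewrite theadE; congr pair; apply: val_inj.
by rewrite [RHS]tuple_eta; apply: val_inj.
Qed.

Hypothesis hA : symmetric_tensor A.

(* Symmetry makes the partial derivatives of A x^m in each of its m slots agree. *)
Lemma tgrad_symE x i (k : 'I_p.+1) :
  \sum_t A t * ((tnth t k == i)%:R * \prod_(l | l != k) x (tnth t l) 0) =
  tgrad A x i 0.
Proof.
rewrite tgradE; pose s := tperm k ord0.
have sK : involutive s by move=> l; rewrite tpermK.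
(* Swapping slot [k] with the first slot permutes the tuples, and [hA] leaves the entries
   unchanged. *)
rewrite (reindex (fun t : p.+1.-tuple 'I_n => [tuple tnth t (s l) | l < p.+1])).
  apply: eq_bigr => t _; rewrite hA tnth_mktuple tpermL; congr (_ * (_ * _)).
  rewrite (reindex_inj (can_inj sK)); apply: eq_big => l.
    by rewrite (canF_eq sK) tpermL.
  by move=> _; rewrite tnth_mktuple sK.
apply: onW_bij; exists (fun t : p.+1.-tuple 'I_n => [tuple tnth t (s l) | l < p.+1]) => t;
  by apply: eq_from_tnth => l; rewrite !tnth_mktuple sK.
Qed.

(** A x^m on the line x + t e_i as a formal polynomial in t, so that the derivative at t = 0 is a
    coefficient. *)
Definition line_poly x i : {poly R} :=
  \sum_t (A t)%:P * \prod_k ((x (tnth t k) 0)%:P + (tnth t k == i)%:R%:P * 'X).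

Lemma horner_line_poly x i t : (line_poly x i).[t] = tform A (x + t *: delta_mx i 0).
Proof.
rewrite horner_sum; apply: eq_bigr => u _; rewrite hornerM hornerC; congr (_ * _).
rewrite horner_prod; apply: eq_bigr => k _.
by rewrite hornerD hornerM !hornerC hornerX !mxE eqxx andbT mulrC.
Qed.

(** The Leibniz rule gives one sum for each of the p+1 slots, and by symmetry these sums are
    equal. *)
Lemma coef1_line_poly x i : (line_poly x i)`_1 = p.+1%:R * tgrad A x i 0.
Proof.
rewrite coef_sum; under eq_bigr => t _.
  rewrite coefCM coef1_prod mulr_sumr.
  under eq_bigr => k _.
    rewrite coefD coefC coefCM coefX /= add0r mulr1.
    under eq_bigr => l _ do rewrite coefD coefC coefCM coefX /= mulr0 addr0.
    over.
  over.
rewrite exchange_big /=; under eq_bigr do rewrite tgrad_symE.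
by rewrite sumr_const card_ord mulr_natl.
Qed.

Lemma is_derive_tform x i :
  is_derive (0 : R) 1 (fun t => tform A (x + t *: delta_mx i 0))
    (p.+1%:R * tgrad A x i 0).
Proof.
(* The linear coefficient is the value at 0 of the formal derivative. *)
rewrite -coef1_line_poly -[_`_1]mulr1n -[1%N]/(0.+1) -coef_deriv -horner_coef0.
by under eq_fun do rewrite -horner_line_poly; exact: is_derive_poly.
Qed.

Lemma tformZ c x : tform A (c *: x) = c ^+ p.+1 * tform A x.
Proof.
rewrite /tform mulr_sumr; apply: eq_bigr => t _; rewrite mulrCA; congr (_ * _).
under eq_bigr do rewrite mxE.
by rewrite big_split /= prodr_const card_ord.
Qed.

(** Row vectors are used here because compactness of the simplex comes from [rV_compact]. *)
Lemma tform_continuous : continuous (fun v : 'rV[R]_n => tform A v^T).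
Proof.
apply: continuous_big => [|t _]; first exact: add_continuous.
have Pc : continuous (fun v : 'rV[R]_n => \prod_(k < p.+1) v^T (tnth t k) 0).
  apply: continuous_big => [|k _]; first exact: mul_continuous.
  under eq_fun do rewrite mxE; exact: coord_continuous.
by move=> v; apply: continuousM; [exact: cst_continuous|exact: Pc].
Qed.

End Tensor.

(** The derivative is also the limit of the difference quotients from the right, which are
    nonnegative. *)
Lemma derive_ge0_right_min (R : realType) (f : R -> R) (d : R) :
  is_derive (0 : R) 1 f d -> (forall t, 0 <= t -> f 0 <= f t) -> 0 <= d.
Proof.
move=> [df <-] fmin; rewrite /derive cvg_at_rightE //; apply: limr_ge.
  have /cvg_ex[l cl] := df; apply/cvg_ex; exists l.
  move=> U /cl /nbhs_ballP[e e0 eU]; exists e => //= t te t0.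
  by apply: eU; rewrite ?gt_eqF.
near=> t; have t0 : 0 <= t by near: t; exact: nbhs_right_ge.
by rewrite /= addr0 [_ *: (1:R)]mulr1 mulr_ge0 // ?invr_ge0 ?subr_ge0 ?fmin.
Unshelve. all: by end_near. Qed.

(** * Minimizing A x^m / G(x) on the simplex *)

Section ParetoSpectrum.
Variables (R : realType) (p n : nat) (A : tensor R p.+1 n).
Variables (G : 'cV[R]_n -> R) (g : 'cV[R]_n -> 'cV[R]_n).
Implicit Types (x y : 'cV[R]_n).
Hypothesis n_gt0 : (0 < n)%N.
Hypothesis G_gt0 : forall x, nonnegv x -> x != 0 -> 0 < G x.
Hypothesis GZ : forall c x, 0 <= c -> G (c *: x) = c ^+ p.+1 * G x.
(** Stated away from 0, where the simplex lies and where real powers of x^T x are differentiable. *)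
Hypothesis G_continuous : forall v : 'rV[R]_n, v != 0 ->
  {for v, continuous (fun v : 'rV[R]_n => G v^T)}.

Let G0 : G 0 = 0.
Proof. by rewrite -(scale0r 0) GZ // expr0n mul0r. Qed.

Let simplex : set 'rV[R]_n :=
  [set v | forall i, `[0, 1]%classic (v 0 i)] `&` [set v | \sum_i v 0 i = 1].

Let simplex_neq0 v : simplex v -> v != 0.
Proof.
move=> [_ /= v1]; apply/eqP => v0; move/eqP: v1.
by rewrite v0 big1 => [|i _]; rewrite ?mxE // eq_sym oner_eq0.
Qed.

Let simplex_compact : compact simplex.
Proof.
apply: compact_closedI.
  by have := @rV_compact R n (fun=> `[0, 1]%classic); apply=> i; exact: segment_compact.
apply: (@closed_comp _ _ (fun v : 'rV[R]_n => \sum_i v 0 i) [set 1]).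
  move=> v _; apply: continuous_big => [|i _]; first exact: add_continuous.
  exact: coord_continuous.
exact: closed_eq.
Qed.

(** The scale [c] is the coordinate sum, positive for a nonzero nonnegative vector. *)
Let simplex_ray y : nonnegv y -> y != 0 ->
  exists c v, [/\ 0 < c, simplex v & y = c *: v^T].
Proof.
move=> y0 yn0; pose c := \sum_i y i 0.
have c_ge0 : 0 <= c by apply: sumr_ge0 => i _; exact: y0.
have cn0 : c != 0.
  apply: contra_neq yn0 => /eqP; rewrite psumr_eq0 => [|i _]; last exact: y0.
  move=> /allP yi0; apply/colP => i; rewrite mxE.
  by apply/eqP; rewrite (implyP (yi0 i _)) // mem_index_enum.
have c_gt0 : 0 < c by rewrite lt_def cn0.
exists c, (c^-1 *: y^T); split=> //; last first.
  by rewrite linearZ /= trmxK scalerA divff // scale1r.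
split=> /= [i|]; last first.
  by under eq_bigr do rewrite !mxE; rewrite -mulr_sumr mulVf.
rewrite in_itv /= !mxE mulr_ge0 ?invr_ge0 //= ler_pdivrMl // mulr1.
by rewrite /c (bigD1 i) //= lerDl sumr_ge0.
Qed.

Lemma tform_ge_min : exists lambda x,
  [/\ nonnegv x, x != 0, tform A x = lambda * G x
    & forall y, nonnegv y -> lambda * G y <= tform A y].
Proof.
have A0 : tform A 0 = 0 by rewrite -(scale0r 0) tformZ expr0n mul0r.
have nonneg_simplex v : simplex v -> nonnegv v^T.
  by move=> [v01 _] i; rewrite mxE; have /andP[] := v01 i.
have Gv v : simplex v -> 0 < G v^T.
  move=> vS; apply: G_gt0; first exact: nonneg_simplex.
  by apply: contra_neq (simplex_neq0 vS) => v0; rewrite -[v]trmxK v0 trmx0.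
pose q (v : 'rV[R]_n) := tform A v^T / G v^T.
have [||v /set_mem vS vmin] := compact_EVT_min _ simplex_compact (f := q).
(* A vertex shows that the simplex is nonempty. *)
- exists (delta_mx 0 (Ordinal n_gt0)); split=> [i|] /=.
    by rewrite in_itv /= mxE ler0n lern1 leq_b1.
  by rewrite (bigD1 (Ordinal n_gt0)) //= big1 => [|i ni];
    rewrite mxE ?eqxx ?addr0 // (negbTE ni) andbF.
- apply: continuous_in_subspaceT => v /set_mem vS.
  have Ac := @tform_continuous _ _ _ A v.
  have Gc := G_continuous (simplex_neq0 vS).
  by apply: (continuousM Ac); apply: continuousV Gc; rewrite gt_eqF ?Gv.
exists (q v), v^T; split; first exact: nonneg_simplex.
- by apply: contra_neq (simplex_neq0 vS) => v0; rewrite -[v]trmxK v0 trmx0.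
- by rewrite divfK // gt_eqF ?Gv.
move=> y y0; have [->|yn0] := eqVneq y 0; first by rewrite G0 A0 mulr0.
(* Both sides scale by c^(p+1), which reduces the bound to the point [w] of the simplex. *)
have [c [w [c0 wS ->]]] := simplex_ray y0 yn0.
rewrite GZ ?(ltW c0) // tformZ mulrCA ler_pM2l ?exprn_gt0 //.
by rewrite -ler_pdivlMr ?Gv // vmin // inE.
Qed.

Hypothesis hA : symmetric_tensor A.
(** Thus [g] is the gradient of G divided by m = p+1, just as A x^(m-1) is that of A x^m. *)
Hypothesis G_derive : forall x i, nonnegv x -> x != 0 ->
  is_derive (0 : R) 1 (fun t => G (x + t *: delta_mx i 0)) (p.+1%:R * g x i 0).

(* E abstracts over the two notions of eigenvalue, with the pair (G, g) equal to
   (x^T x^[m-1], x^[m-1]) or to ((x^T x)^(m/2), (x^T x)^(m/2-1) x). *)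
Variable E : R -> Prop.
Hypothesis E_def : forall lambda, E lambda <-> exists x,
  [/\ x != 0, tform A x = lambda * G x,
      nonnegv (tgrad A x - lambda *: g x) & nonnegv x].

Lemma pareto_spectrum_copositive :
  [/\ exists lambda, E lambda,
      copositive A <-> (forall lambda, E lambda -> 0 <= lambda)
    & strictly_copositive A <-> (forall lambda, E lambda -> 0 < lambda)].
Proof.
have [lambda [x [x0 xn0 xE xmin]]] := tform_ge_min.
have El : E lambda.
  apply/E_def; exists x; split=> // i.
  have -> : (tgrad A x - lambda *: g x) i 0 = tgrad A x i 0 - lambda * g x i 0.
    by rewrite [LHS]mxE; congr (_ + _); rewrite !mxE.
  (* Multiplied by m, the component becomes the derivative at t = 0 of A y^m - lambda G(y) along y =
     x + t e_i. *)
  rewrite -(pmulr_rge0 _ (ltr0Sn R p)).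
  have dA := is_derive_tform hA x i; have dG := G_derive i x0 xn0.
  rewrite mulrBr [_ * (lambda * _)]mulrCA.
  apply: (derive_ge0_right_min (is_deriveB dA (is_deriveZ lambda dG))) => t t0.
  rewrite !fctE /= scale0r addr0 xE -[lambda *: G x]/(lambda * G x) subrr subr_ge0.
  by apply: xmin => j; rewrite !mxE addr_ge0 ?mulr_ge0 ?ler0n.
split; first by exists lambda.
  split=> [cA mu /E_def[y [yn0 yE _ y0]]|E0 y y0].
    by have := cA y y0; rewrite yE pmulr_lge0 // G_gt0.
  apply: le_trans (xmin y y0); have [->|yn0] := eqVneq y 0.
    by rewrite G0 mulr0.
  by apply: mulr_ge0; [exact: E0|exact/ltW/G_gt0].
split=> [cA mu /E_def[y [yn0 yE _ y0]]|E0 y y0 yn0].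
  by have := cA y y0 yn0; rewrite yE pmulr_lgt0 // G_gt0.
by apply: lt_le_trans (xmin y y0); apply: mulr_gt0; [exact: E0|exact: G_gt0].
Qed.

End ParetoSpectrum.

(** * The two normalizations x^T x^[m-1] and (x^T x)^(m/2) *)

Section Norms.
Variables (R : realType) (p n : nat).
Implicit Types (x y : 'cV[R]_n).

Lemma dotvE x y : dotv x y = \sum_i x i 0 * y i 0.
Proof. by rewrite /dotv mxE; apply: eq_bigr => i _; rewrite mxE. Qed.

Lemma dotv_powvE x k : dotv x (powv x k) = \sum_i x i 0 ^+ k.+1.
Proof. by rewrite dotvE; apply: eq_bigr => i _; rewrite mxE -exprS. Qed.

Lemma dotv_line x i t :
  dotv (x + t *: delta_mx i 0) (x + t *: delta_mx i 0) =
  dotv x x + (x i 0 *+ 2 * t + t ^+ 2).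
Proof.
rewrite !dotvE (bigD1 i) //= [in RHS](bigD1 i) //=.
under eq_bigr => j ji do rewrite !mxE (negbTE ji) mulr0 addr0.
by rewrite !mxE !eqxx /=; ring.
Qed.

Lemma dotv_powv_line x k i t :
  dotv (x + t *: delta_mx i 0) (powv (x + t *: delta_mx i 0) k) =
  dotv x (powv x k) - x i 0 ^+ k.+1 + (x i 0 + t) ^+ k.+1.
Proof.
rewrite !dotv_powvE (bigD1 i) //= [in RHS](bigD1 i) //=.
under eq_bigr => j ji do rewrite !mxE (negbTE ji) mulr0 addr0.
by rewrite !mxE !eqxx mulr1 /=; ring.
Qed.

Lemma dotv_gt0 x : x != 0 -> 0 < dotv x x.
Proof.
move=> xn0; rewrite dotvE lt_def sumr_ge0 => [|i _]; last exact: sqr_ge0.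
rewrite andbT; apply: contra_neq xn0 => /eqP.
rewrite psumr_eq0 => [/allP xi0|i _]; last exact: sqr_ge0.
apply/colP => i; rewrite mxE; apply/eqP.
by have := xi0 i (mem_index_enum _); rewrite mulf_eq0 orbb.
Qed.

(** The sum consists of the powers x_i^(p+1), which for odd exponent are nonnegative only thanks to
    x >= 0. *)
Lemma dotv_powv_gt0 x : nonnegv x -> x != 0 -> 0 < dotv x (powv x p).
Proof.
move=> x0 xn0; rewrite dotv_powvE.
have xp0 i : 0 <= x i 0 ^+ p.+1 by rewrite exprn_ge0.
rewrite lt_def sumr_ge0 // andbT; apply: contra_neq xn0 => /eqP.
rewrite psumr_eq0 => [/allP xi0|//].
apply/colP => i; rewrite mxE; apply/eqP.
by have := xi0 i (mem_index_enum _); rewrite expf_eq0.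
Qed.

Lemma dotv_powvZ c x : dotv (c *: x) (powv (c *: x) p) = c ^+ p.+1 * dotv x (powv x p).
Proof.
rewrite !dotv_powvE mulr_sumr; apply: eq_bigr => i _.
by rewrite mxE exprMn.
Qed.

Lemma powR_dotvZ c x : 0 <= c ->
  dotv (c *: x) (c *: x) `^ (p.+1%:R / 2) = c ^+ p.+1 * dotv x x `^ (p.+1%:R / 2).
Proof.
move=> c0; have -> : dotv (c *: x) (c *: x) = c ^+ 2 * dotv x x.
  rewrite !dotvE mulr_sumr; apply: eq_bigr => i _.
  by rewrite !mxE; ring.
rewrite powRM ?exprn_ge0 //; last first.
  by rewrite dotvE sumr_ge0 // => i _; exact: sqr_ge0.
(* For c >= 0 the real power (c^2)^(m/2) is c^m. *)
by rewrite -powR_mulrn // -powRrM [2%:R * _]mulrC divfK ?powR_mulrn // pnatr_eq0.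
Qed.

Lemma dotv_powv_continuous k :
  continuous (fun v : 'rV[R]_n => dotv v^T (powv v^T k)).
Proof.
under eq_fun do rewrite dotv_powvE.
apply: continuous_big => [|i _]; first exact: add_continuous.
under eq_fun do rewrite mxE; move=> v.
apply: (@continuous_comp _ _ _ (fun v : 'rV[R]_n => v 0 i) (fun s : R => s ^+ k.+1)).
  exact: coord_continuous.
exact: exprn_continuous.
Qed.

Lemma powR_dotv_continuous a (v : 'rV[R]_n) : v != 0 ->
  {for v, continuous (fun v : 'rV[R]_n => dotv v^T v^T `^ a)}.
Proof.
move=> vn0; apply: (@continuous_comp _ _ _ _ (fun s : R => s `^ a)).
  have -> : (fun v : 'rV[R]_n => dotv v^T v^T) =
            (fun v : 'rV[R]_n => dotv v^T (powv v^T 1)).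
    by apply/funext => w; congr dotv; apply/colP => i; rewrite !mxE expr1.
  exact: dotv_powv_continuous.
(* A real power is differentiable, hence continuous, at the positive number x^T x. *)
apply/differentiable_continuous/derivable1_diffP.
apply: derivable_powR; rewrite in_itv /= andbT dotv_gt0 //.
by apply: contra_neq vn0 => v0; rewrite -[v]trmxK v0 trmx0.
Qed.

(** Only the i-th summand varies with t, and it is a polynomial in t. *)
Lemma is_derive_dotv_powv x i :
  is_derive (0 : R) 1
    (fun t => dotv (x + t *: delta_mx i 0) (powv (x + t *: delta_mx i 0) p))
    (p.+1%:R * powv x p i 0).
Proof.
under eq_fun do rewrite dotv_powv_line.
pose q : {poly R} := (dotv x (powv x p) - x i 0 ^+ p.+1)%:P +
  ((x i 0)%:P + 'X) ^+ p.+1.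
have -> : (fun t => dotv x (powv x p) - x i 0 ^+ p.+1 + (x i 0 + t) ^+ p.+1) =
  horner q by apply/funext => t; rewrite !hornerE.
apply: is_derive_eq (is_derive_poly q 0) _.
rewrite derivD derivC add0r deriv_exp derivD derivC derivX add0r mul1r /=.
by rewrite hornerMn !hornerE mxE mulr_natl.
Qed.

(** Chain rule at x^T x > 0; for a = m/2 the factor [a * 2] is m. *)
Lemma is_derive_powR_dotv a x i : x != 0 ->
  is_derive (0 : R) 1
    (fun t => dotv (x + t *: delta_mx i 0) (x + t *: delta_mx i 0) `^ a)
    (a * 2 * (dotv x x `^ (a - 1) *: x) i 0).
Proof.
move=> xn0; under eq_fun do rewrite dotv_line.
pose q : {poly R} := (dotv x x)%:P + ((x i 0 *+ 2)%:P * 'X + 'X ^+ 2).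
have q0 : q.[0] = dotv x x by rewrite !hornerE /= expr0n !addr0.
have dP : is_derive q.[0] 1 (fun s => s `^ a) (a * q.[0] `^ (a - 1)).
  by apply: is_derive1_powR; rewrite q0 dotv_gt0.
have := is_derive1_comp dP (is_derive_poly q 0).
have -> : (fun s => s `^ a) \o horner q =
    (fun t => (dotv x x + (x i 0 *+ 2 * t + t ^+ 2)) `^ a).
  by apply/funext => t /=; rewrite !hornerE.
suff -> : a * q.[0] `^ (a - 1) * q^`().[0] =
          a * 2 * (dotv x x `^ (a - 1) *: x) i 0 by [].
rewrite q0 mxE 2!derivD derivC derivM derivC derivX derivXn !hornerE.
by rewrite /=; ring.
Qed.

End Norms.

(** * H- and Z-eigenvalues as instances of the general argument *)

Theorem corollary4p5 (R : realType) (m n : nat) (hm : (2 <= m)%N) (hn : (1 <= n)%N)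
    (A : tensor R m n) (hA : symmetric_tensor A) :
  [/\ exists lambda : R, pareto_H_eigenvalue A lambda,
      copositive A <->
        (forall lambda : R, pareto_H_eigenvalue A lambda -> 0 <= lambda)
    & strictly_copositive A <->
        (forall lambda : R, pareto_H_eigenvalue A lambda -> 0 < lambda)] /\
  [/\ exists mu : R, pareto_Z_eigenvalue A mu,
      copositive A <->
        (forall mu : R, pareto_Z_eigenvalue A mu -> 0 <= mu)
    & strictly_copositive A <->
        (forall mu : R, pareto_Z_eigenvalue A mu -> 0 < mu)].
Proof.
(* Writing m = p+1 exposes the first index in [tgrad] and turns [m.-1] into p. *)
case: m hm A hA => [//|p] _ A hA; split.
  apply: (@pareto_spectrum_copositive _ _ _ A (fun x => dotv x (powv x p))
    (fun x => powv x p)) => //.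
  - exact: dotv_powv_gt0.
  - by move=> c x _; exact: dotv_powvZ.
  - by move=> v _; exact: dotv_powv_continuous.
  - by move=> x i _ _; exact: is_derive_dotv_powv.
apply: (@pareto_spectrum_copositive _ _ _ A (fun x => dotv x x `^ (p.+1%:R / 2))
  (fun x => dotv x x `^ (p.+1%:R / 2 - 1) *: x)) => //.
- by move=> x _ xn0; rewrite powR_gt0 ?dotv_gt0.
- exact: powR_dotvZ.
- exact: powR_dotv_continuous.
- by move=> x i _ xn0; have := is_derive_powR_dotv (p.+1%:R / 2) i xn0;
    rewrite divfK ?pnatr_eq0.
(* The two forms of the inequality differ by associativity of scaling. *)
- by move=> mu; split=> -[x [xn0 xE gx x0]]; exists x; split=> //;
    move: gx; rewrite scalerA.
Qed.
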